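(* If a GDatalog[$\Delta$] program $\mathcal{G}=(\mathcal{E},\mathcal{I},\Theta)$ is weakly acyclic, then $\Omega_{\mathcal{G}}(I)=\Omega^{\mathsf{fin}}_{\mathcal{G}}(I)$ for all input instances $I$; that is, every possible outcome of every input instance $I$ w.r.t. $\mathcal{G}$ is finite.
   Context: Schemas, facts, instances. A schema is a collection of relation symbols $R$, each with an arity $\mathrm{arity}(R)\in\mathbb{N}$. A fact over a schema is an expression $R(c_1,\dots,c_n)$ with $R$ an $n$-ary symbol of the schema and $c_1,\dots,c_n\in\mathbb{R}$. An instance is a finite set of facts. An atom is $R(t_1,\dots,t_n)$ where each $t_i$ is a constant (real number) or a variable. Distributions. A parameterized numerical (discrete) distribution is a function $\delta:\Omega_\delta\times\mathbb{R}^k\to[0,1]$ with $\Omega_\delta\subseteq\mathbb{R}$ finite or countably infinite, such that $\sum_{o\in\Omega_\delta}\delta(o,\mathbf{p})=1$ for all $\mathbf{p}\in\mathbb{R}^k$; $k$ is denoted $\mathrm{pardim}(\delta)$. Write $\delta(o|\mathbf{p})$ for $\delta(o,\mathbf{p})$, and put $\delta(b|\mathbf{p})=0$ for $b\in\mathbb{R}\setminus\Omega_\delta$. GDatalog[$\Delta$]. Let $\Delta$ be a finite set of parameterized numerical distributions. A $\Delta$-term is $\delta[p_1,\dots,p_k]$ with $\delta\in\Delta$, $k=\mathrm{pardim}(\delta)$, each $p_i$ a variable or constant. A $\Delta$-atom is $R(t_1,\dots,t_n)$ where exactly one $t_i$ is a $\Delta$-term and all other $t_j$ are constants or variables. A GDatalog[$\Delta$]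 program is $\mathcal{G}=(\mathcal{E},\mathcal{I},\Theta)$ with $\mathcal{E},\mathcal{I}$ disjoint schemas and $\Theta$ a finite set of rules $\forall\mathbf{x}(\psi(\mathbf{x})\leftarrow\varphi(\mathbf{x}))$, where $\varphi$ is a conjunction of atoms over $\mathcal{E}\cup\mathcal{I}$, $\psi$ is an atom or a $\Delta$-atom over $\mathcal{I}$, and every variable of $\mathbf{x}$ occurs in $\varphi$. An input instance for $\mathcal{G}$ is an instance over $\mathcal{E}$. Associated program $\widehat{\mathcal{G}}=(\mathcal{E},\mathcal{I}^\Delta,\Theta^\Delta)$. $\mathcal{I}^\Delta$ extends $\mathcal{I}$ with a new ''distributional'' relation symbol $R^\delta_i$ of arity $\mathrm{arity}(R)+\mathrm{pardim}(\delta)$ whenever some rule of $\Theta$ contains a $\Delta$-atom over $R$ with a term $\delta[\dots]$ in position $i$. $\Theta^\Delta$ consists of: (a) all rules of $\Theta$ without $\Delta$-terms; (b) the rule $\exists y\,R^\delta_i(\mathbf{t},y,\mathbf{t}',\mathbf{p})\leftarrow\varphi(\mathbf{x})$ for every rule $R(\mathbf{t},\delta[\mathbf{p}],\mathbf{t}')\leftarrow\varphi(\mathbf{x})$ of $\Theta$ with $\delta[\mathbf{p}]$ in position $i$ ($y$ is then in position $i$); (c) the rule $R(\mathbf{x})\leftarrow R^\delta_i(\mathbf{x},\mathbf{p})$ for every distributional symbol $R^\delta_i$. Possible outcomes. A solution of $I$ w.r.t. $\widehat{\mathcal{G}}$ is a possibly infinite set $J$ of facts over $\mathcal{E}\cup\mathcal{I}^\Delta$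 with $I\subseteq J$ satisfying all rules of $\Theta^\Delta$ as first-order sentences; it is minimal if no proper subset of it is a solution. A possible outcome of $I$ w.r.t. $\mathcal{G}$ is a minimal solution $J$ such that $\delta(b|\mathbf{p})>0$ for every distributional fact $R^\delta_i(\mathbf{a},b,\mathbf{c},\mathbf{p})\in J$ with $b$ in position $i$. $\Omega_{\mathcal{G}}(I)$ is the set of all possible outcomes and $\Omega^{\mathsf{fin}}_{\mathcal{G}}(I)$ the set of finite ones. Weak acyclicity. A position of $\mathcal{I}$ is a pair $(R,i)$ with $R\in\mathcal{I}$ and $i\in\{1,\dots,\mathrm{arity}(R)\}$. The dependency graph of $\mathcal{G}$ is the directed graph whose nodes are the positions of $\mathcal{I}$, with the following edges. Normal edge $(R,i)\to(S,j)$: whenever there are a rule $\psi(\mathbf{x})\leftarrow\varphi(\mathbf{x})$ in $\Theta$ and a variable $x$ occurring at position $(R,i)$ in $\varphi(\mathbf{x})$ and at position $(S,j)$ in $\psi(\mathbf{x})$. Special edge $(R,i)\to^*(S,j)$: whenever there are a rule $S(t_1,\dots,t_{j-1},\delta[\mathbf{p}],t_{j+1},\dots,t_n)\leftarrow\varphi(\mathbf{x})$ in $\Theta$ and an exported variable at position $(R,i)$ in $\varphi(\mathbf{x})$, where an exported variable is one appearing in both the premise and the conclusion of the rule (including among the parameters $\mathbf{p}$). $\mathcal{G}$ is weakly acyclic if no (directed) cycle in its dependency graph contains a special edge. *)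

(* Defs.v *)
From Stdlib Require List.
From mathcomp Require Import all_boot all_order all_algebra.
From mathcomp Require Import all_classical all_reals all_analysis.

Set Implicit Arguments.
Unset Strict Implicit.
Unset Printing Implicit Defensive.

Import Order.TTheory GRing.Theory Num.Theory.

Local Open Scope classical_set_scope.
Local Open Scope ring_scope.

(** * Terms, atoms and facts

    A signature is a type [S] of relation symbols with [ar : S -> nat]; a
    schema is a set of symbols. *)

Inductive term (R V : Type) : Type :=
| Var of V
| Cst of R.

Arguments Var {R V}.
Arguments Cst {R V}.

Definition term_map {R V W : Type} (f : V -> W) (t : term R V) : term R W :=
  match t with Var x => Var (f x) | Cst c => Cst c end.

Definition term_eval {R V : Type} (nu : V -> R) (t : term R V) : R :=
  match t with Var x => nu x | Cst c => c end.

Record atom (R V S : Type) (ar : S -> nat) := Atom {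
  atom_sym : S;
  atom_args : (ar atom_sym).-tuple (term R V) }.

Record fact (R S : Type) (ar : S -> nat) := Fact {
  fact_sym : S;
  fact_args : (ar fact_sym).-tuple R }.

Definition atom_vars {R V S : Type} {ar : S -> nat} (a : atom R V ar) : set V :=
  [set x | exists i, tnth (atom_args a) i = Var x].

Definition atom_eval {R V S : Type} {ar : S -> nat} (nu : V -> R)
    (a : atom R V ar) : fact R ar :=
  Fact (map_tuple (term_eval nu) (atom_args a)).

(** [insert_at i y t] is the tuple with [y] in position [i] whose remaining
    components are, in order, those of [t]. *)
Definition insert_at {T : Type} {n : nat} (i : 'I_n) (y : T)
    (t : n.-1.-tuple T) : n.-tuple T :=
  [tuple oapp (tnth t) y (unlift i j) | j < n].

(** * Parameterized discrete numerical distributions *)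

(** [prob] is total on [R]: it is the extension by [0] outside the sample
    space of the function on [sample_space * R^pardim]. *)
Record num_distribution (R : realType) := NumDistribution {
  pardim : nat;
  sample_space : set R;
  prob : R -> pardim.-tuple R -> R;
  sample_space_countable : countable sample_space;
  prob_ge0 : forall o p, 0 <= prob o p;
  prob_le1 : forall o p, prob o p <= 1;
  prob_out : forall o p, ~ sample_space o -> prob o p = 0;
  prob_sum1 : forall p, (\esum_(o in sample_space) (prob o p)%:E = 1)%E }.

Arguments prob {R} d o p : rename.

(** * GDatalog programs *)

(** The Delta-atom with symbol [datom_sym], the Delta-term
    [datom_dist[datom_params]] in position [datom_pos], and the ordinary terms
    [datom_others] in the other positions. *)
Record datom (R : realType) (V S : Type) (ar : S -> nat) := DAtom {
  datom_sym : S;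
  datom_pos : 'I_(ar datom_sym);
  datom_dist : num_distribution R;
  datom_params : (pardim datom_dist).-tuple (term R V);
  datom_others : (ar datom_sym).-1.-tuple (term R V) }.

Definition datom_vars {R : realType} {V S : Type} {ar : S -> nat}
    (d : datom R V ar) : set V :=
  [set x | (exists i, tnth (datom_others d) i = Var x) \/
           (exists i, tnth (datom_params d) i = Var x)].

Inductive ghead (R : realType) (S : Type) (ar : S -> nat) : Type :=
| AtomHead of atom R nat ar
| DAtomHead of datom R nat ar.

Definition ghead_sym {R : realType} {S : Type} {ar : S -> nat}
    (h : ghead R ar) : S :=
  match h with AtomHead a => atom_sym a | DAtomHead d => datom_sym d end.

Definition ghead_vars {R : realType} {S : Type} {ar : S -> nat}
    (h : ghead R ar) : set nat :=
  match h with AtomHead a => atom_vars a | DAtomHead d => datom_vars d end.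

(** The rule [forall x, head <- conjunction of the atoms of body]; variables
    are natural numbers. *)
Record grule (R : realType) (S : Type) (ar : S -> nat) := GRule {
  gbody : seq (atom R nat ar);
  gconcl : ghead R ar }.

Definition gbody_vars {R : realType} {S : Type} {ar : S -> nat}
    (r : grule R ar) : set nat :=
  [set x | exists2 a, List.In a (gbody r) & atom_vars a x].

Definition wf_grule {R : realType} {S : Type} {ar : S -> nat}
    (Delta : set (num_distribution R)) (E I : set S) (r : grule R ar) : Prop :=
  [/\ forall a, List.In a (gbody r) -> (E `|` I) (atom_sym a),
      I (ghead_sym (gconcl r)),
      forall d, gconcl r = DAtomHead d -> Delta (datom_dist d) &
      ghead_vars (gconcl r) `<=` gbody_vars r].

Record program (R : realType) (S : Type) (ar : S -> nat)
    (Delta : set (num_distribution R)) := Program {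
  edb : set S;
  idb : set S;
  rules : set (grule R ar);
  edb_idb_disjoint : edb `&` idb = set0;
  rules_finite : finite_set rules;
  rules_wf : forall r, rules r -> wf_grule Delta edb idb r }.

Definition input_instance {R : realType} {S : Type} {ar : S -> nat}
    {Delta : set (num_distribution R)} (G : program ar Delta)
    (I : set (fact R ar)) : Prop :=
  finite_set I /\ forall f, I f -> edb G (fact_sym f).

(** * Existential Datalog rules *)

(** In [ExistsHead a] the variable [None] is existentially quantified, and
    [Some x] is the variable [x] of the premise. *)
Inductive ehead (R S : Type) (ar : S -> nat) : Type :=
| PlainHead of atom R nat ar
| ExistsHead of atom R (option nat) ar.

Record erule (R S : Type) (ar : S -> nat) := ERule {
  ebody : seq (atom R nat ar);
  econcl : ehead R ar }.

Definition ehead_sat {R S : Type} {ar : S -> nat} (J : set (fact R ar))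
    (nu : nat -> R) (h : ehead R ar) : Prop :=
  match h with
  | PlainHead a => J (atom_eval nu a)
  | ExistsHead a => exists y : R, J (atom_eval (oapp nu y) a)
  end.

Definition erule_sat {R S : Type} {ar : S -> nat} (J : set (fact R ar))
    (r : erule R ar) : Prop :=
  forall nu : nat -> R,
    (forall a, List.In a (ebody r) -> J (atom_eval nu a)) ->
    ehead_sat J nu (econcl r).

(** * The associated existential program *)

(** [DistSym r i d] is the distributional symbol [r^d_i]. *)
Inductive xsym (R : realType) (S : Type) (ar : S -> nat) : Type :=
| BaseSym of S
| DistSym (r : S) of 'I_(ar r) & num_distribution R.

Arguments BaseSym {R S ar}.
Arguments DistSym {R S ar}.

Definition xar {R : realType} {S : Type} {ar : S -> nat}
    (s : xsym R ar) : nat :=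
  match s with
  | BaseSym r => ar r
  | DistSym r _ d => (ar r + pardim d)%N
  end.

Definition base_fact {R : realType} {S : Type} {ar : S -> nat}
    (f : fact R ar) : fact R (@xar R S ar) :=
  @Fact R _ xar (BaseSym (fact_sym f)) (fact_args f).

(** [r^d_i(a, p)], where the sampled value is the [i]-th component of [a]. *)
Definition dist_fact {R : realType} {S : Type} {ar : S -> nat} (r : S)
    (i : 'I_(ar r)) (d : num_distribution R) (a : (ar r).-tuple R)
    (p : (pardim d).-tuple R) : fact R (@xar R S ar) :=
  @Fact R _ xar (DistSym r i d) [tuple of a ++ p].

Definition base_atom {R : realType} {S : Type} {ar : S -> nat}
    (a : atom R nat ar) : atom R nat (@xar R S ar) :=
  @Atom R nat _ xar (BaseSym (atom_sym a)) (atom_args a).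

Definition exists_atom {R : realType} {S : Type} {ar : S -> nat}
    (d : datom R nat ar) : atom R (option nat) (@xar R S ar) :=
  @Atom R (option nat) _ xar
    (DistSym (datom_sym d) (datom_pos d) (datom_dist d))
    [tuple of insert_at (datom_pos d) (Var None)
                (map_tuple (term_map Some) (datom_others d))
              ++ map_tuple (term_map Some) (datom_params d)].

Definition xrule {R : realType} {S : Type} {ar : S -> nat}
    (r : grule R ar) : erule R (@xar R S ar) :=
  ERule (map base_atom (gbody r))
    match gconcl r with
    | AtomHead a => PlainHead (base_atom a)
    | DAtomHead d => ExistsHead (exists_atom d)
    end.

(** The rule [r(x) <- r^d_i(x, p)], with [x] and [p] tuples of distinct
    variables. *)
Definition projection_rule {R : realType} {S : Type} {ar : S -> nat} (r : S)
    (i : 'I_(ar r)) (d : num_distribution R) : erule R (@xar R S ar) :=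
  ERule
    [:: @Atom R nat _ xar (DistSym r i d)
          [tuple Var (j : nat) | j < ar r + pardim d]]
    (PlainHead (@Atom R nat _ xar (BaseSym r)
                  [tuple Var (j : nat) | j < ar r])).

Definition is_dist_sym {R : realType} {S : Type} {ar : S -> nat}
    {Delta : set (num_distribution R)} (G : program ar Delta) (r : S)
    (i : 'I_(ar r)) (d : num_distribution R) : Prop :=
  exists2 rl, rules G rl &
    exists p t, gconcl rl = DAtomHead (@DAtom R nat S ar r i d p t).

Definition xidb {R : realType} {S : Type} {ar : S -> nat}
    {Delta : set (num_distribution R)} (G : program ar Delta) :
    set (xsym R ar) :=
  fun s => match s with
           | BaseSym r => idb G r
           | DistSym r i d => is_dist_sym G i d
           end.

Definition xrules {R : realType} {S : Type} {ar : S -> nat}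
    {Delta : set (num_distribution R)} (G : program ar Delta) :
    set (erule R (@xar R S ar)) :=
  [set xrule r | r in rules G] `|`
  [set e | exists r (i : 'I_(ar r)) d,
             is_dist_sym G i d /\ e = projection_rule i d].

(** * Solutions and possible outcomes *)

Definition solution {R : realType} {S : Type} {ar : S -> nat}
    {Delta : set (num_distribution R)} (G : program ar Delta)
    (I : set (fact R ar)) (J : set (fact R (@xar R S ar))) : Prop :=
  [/\ forall f, J f -> ([set BaseSym r | r in edb G] `|` xidb G) (fact_sym f),
      [set base_fact f | f in I] `<=` J &
      forall e, xrules G e -> erule_sat J e].

Definition minimal_solution {R : realType} {S : Type} {ar : S -> nat}
    {Delta : set (num_distribution R)} (G : program ar Delta)
    (I : set (fact R ar)) (J : set (fact R (@xar R S ar))) : Prop :=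
  solution G I J /\ forall J', J' `<` J -> ~ solution G I J'.

Definition possible_outcomes {R : realType} {S : Type} {ar : S -> nat}
    {Delta : set (num_distribution R)} (G : program ar Delta)
    (I : set (fact R ar)) : set (set (fact R (@xar R S ar))) :=
  [set J | minimal_solution G I J /\
     forall r (i : 'I_(ar r)) (d : num_distribution R) a p,
       J (dist_fact i a p) -> 0 < prob d (tnth a i) p].

Definition fin_possible_outcomes {R : realType} {S : Type} {ar : S -> nat}
    {Delta : set (num_distribution R)} (G : program ar Delta)
    (I : set (fact R ar)) : set (set (fact R (@xar R S ar))) :=
  [set J | possible_outcomes G I J /\ finite_set J].

(** * Weak acyclicity *)

Record position (S : Type) (ar : S -> nat) := Position {
  pos_sym : S;
  pos_index : 'I_(ar pos_sym) }.

Definition atom_occurs {R V S : Type} {ar : S -> nat} (x : V)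
    (a : atom R V ar) (q : position ar) : Prop :=
  exists2 i, tnth (atom_args a) i = Var x & q = Position i.

Definition body_occurs {R : realType} {S : Type} {ar : S -> nat} (x : nat)
    (r : grule R ar) (q : position ar) : Prop :=
  exists2 a, List.In a (gbody r) & atom_occurs x a q.

Definition head_occurs {R : realType} {S : Type} {ar : S -> nat} (x : nat)
    (h : ghead R ar) (q : position ar) : Prop :=
  match h with
  | AtomHead a => atom_occurs x a q
  | DAtomHead d => exists2 j, tnth (datom_others d) j = Var x &
                              q = Position (lift (datom_pos d) j)
  end.

Inductive edge_kind := Normal | Special.

(** The targets of edges are always positions of [idb G]; only the sources
    have to be restricted. *)
Definition edge {R : realType} {S : Type} {ar : S -> nat}
    {Delta : set (num_distribution R)} (G : program ar Delta) (k : edge_kind)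
    (q q' : position ar) : Prop :=
  idb G (pos_sym q) /\
  exists2 r, rules G r & exists2 x, body_occurs x r q &
    match k with
    | Normal => head_occurs x (gconcl r) q'
    | Special => exists d, [/\ gconcl r = DAtomHead d, datom_vars d x &
                               q' = Position (datom_pos d)]
    end.

(** The closed directed walk through [q 0, ..., q n] and back to [q 0] whose
    [i]-th edge has kind [k i]; [ordS] is the successor modulo [n.+1]. *)
Definition dependency_cycle {R : realType} {S : Type} {ar : S -> nat}
    {Delta : set (num_distribution R)} (G : program ar Delta) (n : nat)
    (q : 'I_n.+1 -> position ar) (k : 'I_n.+1 -> edge_kind) : Prop :=
  forall i, edge G (k i) (q i) (q (ordS i)).

Definition weakly_acyclic {R : realType} {S : Type} {ar : S -> nat}
    {Delta : set (num_distribution R)} (G : program ar Delta) : Prop :=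
  forall n (q : 'I_n.+1 -> position ar) k,
    dependency_cycle G q k -> forall i, k i <> Special.

(* Main.v *)
(** In a minimal solution [J] the sampled component of a distributional fact is
    determined by its other components: of two facts differing only there, one
    could be dropped, since distributional facts are needed only as witnesses
    of existential heads. By weak acyclicity, positions carry a rank that is
    nondecreasing along normal edges and increasing along special ones. Let
    [V 0] consist of the constants of the input and of the rule heads, and let
    [V k.+1] add to [V k] all samples occurring in [J] next to values of
    [V k]; by uniqueness of samples, each [V k] is finite. The facts of [J] that
    belong to the input, or whose value at every position [q] lies in
    [V (rank q).+1], form a solution, hence all of [J] by minimality. As ranks
    are bounded, only finitely many facts have this form. *)

Require Import Defs.
From mathcomp Require Import all_boot all_order all_algebra.
From mathcomp Require Import all_classical all_reals all_analysis.

Set Implicit Arguments.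
Unset Strict Implicit.
Unset Printing Implicit Defensive.

Local Open Scope classical_set_scope.

(** * Finiteness and counting *)

Lemma finite_tuples (T : eqType) (n : nat) (A : set T) :
  finite_set A -> finite_set [set t : n.-tuple T | forall i, A (tnth t i)].
Proof.
case: n => [|n].
  by move=> _; apply: sub_finite_set (finite_set1 [tuple]) => t _;
    exact: tuple0.
have [[x0 _]|A0] := pselect (exists x, A x); last first.
  move=> _; apply: sub_finite_set (finite_set0 _) => t /(_ ord0) At.
  by apply: A0; exists (tnth t ord0).
move=> /finite_seqP[s ->].
(* A tuple is encoded by the indices of its entries in [s]; the extra index makes the codomain an
   inhabited ordinal type, as [inord] requires. *)
pose F (f : {ffun 'I_n.+1 -> 'I_(size s).+1}) : n.+1.-tuple T :=
  [tuple nth x0 s (f i) | i < n.+1].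
apply: sub_finite_set (finite_image F (@finite_finset _ setT)) => t st.
exists [ffun i => inord (index (tnth t i) s)] => //.
apply: eq_from_tnth => i; rewrite tnth_mktuple ffunE inordK ?nth_index//.
  exact: st.
by rewrite ltnS index_size.
Qed.

Lemma ltn_count (T : eqType) (a b : pred T) (s : seq T) x :
  subpred a b -> x \in s -> ~~ a x -> b x -> count a s < count b s.
Proof.
move=> ab + ax bx; elim: s => //= y s IHs.
rewrite inE => /orP[/eqP <-|/IHs lt_ab].
  by rewrite (negbTE ax) bx add0n add1n ltnS sub_count.
by rewrite -addnS leq_add//; case: (boolP (a y)) => // /ab ->.
Qed.

Lemma finite_range_ord (T : Type) (n : nat) (f : 'I_n -> T) :
  finite_set (range f).
Proof. by apply: finite_image; exact: finite_finset. Qed.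

Section InsertAt.
Context {T : Type} {n : nat}.

Lemma tnth_insert_at (i : 'I_n) (y : T) t : tnth (insert_at i y t) i = y.
Proof. by rewrite tnth_mktuple unlift_none. Qed.

Lemma tnth_insert_at_lift (i : 'I_n) (y : T) t j :
  tnth (insert_at i y t) (lift i j) = tnth t j.
Proof. by rewrite tnth_mktuple liftK. Qed.

End InsertAt.

(** * Ranks of positions *)

Section Rank.
Context {R : realType} {S : Type} {ar : S -> nat}.
Context {Delta : set (num_distribution R)} (G : program ar Delta).

(** Only [f] up to [n] and [k] below [n] matter; total functions on [nat] allow a walk to be
    extended without ordinal casts. *)
Definition reaches (p q : position ar) : Prop :=
  exists n (f : nat -> position ar) (k : nat -> edge_kind),
    [/\ f 0 = p, f n = q & forall i, i < n -> edge G (k i) (f i) (f i.+1)].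

Lemma reaches_refl p : reaches p p.
Proof. by exists 0, (fun=> p), (fun=> Normal). Qed.

Lemma reaches_edge p q q' k : reaches p q -> edge G k q q' -> reaches p q'.
Proof.
move=> [n [f [kf [f0 fn fE]]]] qq'.
exists n.+1, (fun i => if i <= n then f i else q'),
  (fun i => if i < n then kf i else k).
split=> [//||i]; first by rewrite ltnn.
rewrite ltnS => le_in; have := le_in; rewrite {1}leq_eqVlt.
move=> /orP[/eqP ->|lt_in]; last first.
  by rewrite lt_in le_in; exact: fE.
by rewrite ltnn leqnn fn.
Qed.

(** Such an edge would close the walk from [p] to [q] into a cycle, with index [n] as its special
    edge. *)
Lemma reaches_no_special p q :
  weakly_acyclic G -> reaches p q -> ~ edge G Special q p.
Proof.
move=> wa [n [f [k [f0 fn fE]]]] qp.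
pose k' (i : 'I_n.+1) := if i < n then k i else Special.
apply: (wa n (fun i => f i) k' _ ord_max); last by rewrite /k' /= ltnn.
move=> i; rewrite /k' /=; case: ltnP => [lt_in|le_ni].
  by rewrite modn_small//; exact: fE.
have -> : i = n :> nat by apply/eqP; rewrite eqn_leq le_ni -ltnS ltn_ord.
by rewrite modnn f0 fn.
Qed.

(** The rank of [q] counts the rules whose sampled position reaches [q]. Along any edge no such rule
    is lost. A special edge gains the rule that induces it: were that rule already counted at the
    source, its sampled position would reach the source and the edge would lead back. *)
Lemma exists_rank : weakly_acyclic G ->
  exists (rank : position ar -> nat) (N : nat),
    [/\ forall q, rank q <= N,
        forall q q', edge G Normal q q' -> rank q <= rank q' &
        forall q q', edge G Special q q' -> rank q < rank q'].
Proof.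
move=> wa.
(* Classical decidable equality on rules turns the finite set into a list that [count] can run
   over. *)
have /finite_seqP[s sE] : finite_set (rules G : set {classic grule R ar}).
  exact: rules_finite.
pose P q (r : {classic grule R ar}) := `[< exists d : datom R nat ar,
  gconcl r = DAtomHead d /\ reaches (Position (datom_pos d)) q >].
have PS k q q' : edge G k q q' -> subpred (P q) (P q').
  move=> qq' r /asboolP[d [rd dq]]; apply/asboolP; exists d; split => //.
  exact: reaches_edge dq qq'.
exists (fun q => count (P q) s), (size s); split.
- by move=> q; exact: count_size.
- by move=> q q' /PS/sub_count.
- move=> q q' qq'; have := qq'; move=> [iq [r rr [x xr [d [rd dx q'E]]]]].
  have rs : r \in (s : seq {classic grule R ar}).
    by move: rr; rewrite sE.
  have Pq : ~~ P q r.
    apply/asboolPn => -[d' [rd' d'q]]; move: rd'; rewrite rd => -[dd'].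
    by subst d'; apply: (reaches_no_special wa d'q); rewrite -q'E.
  have Pq' : P q' r.
    by apply/asboolP; exists d; split; rewrite // q'E; exact: reaches_refl.
  exact: ltn_count (PS _ _ _ qq') rs Pq Pq'.
Qed.

End Rank.

(** * Changing the sample of a distributional fact *)

Section Resample.
Context {R : realType} {S : Type} {ar : S -> nat}.

(** Base facts are fixed, so a fact moved by [resample] is distributional. *)
Definition resample (y : R) (f : fact R (@xar R S ar)) :
    fact R (@xar R S ar) :=
  match fact_sym f as s return (xar s).-tuple R -> fact R (@xar R S ar) with
  | BaseSym r => fun a => @Fact R _ xar (BaseSym r) a
  | DistSym r i d => fun a => @Fact R _ xar (DistSym r i d)
      [tuple if j == lshift _ i then y else tnth a j | j < ar r + pardim d]
  end (fact_args f).

(** An equality of facts yields one of samples through this projection, without inverting dependent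
    records; [0] is a dummy value. *)
Definition sampled (f : fact R (@xar R S ar)) : R :=
  match fact_sym f as s return (xar s).-tuple R -> R with
  | BaseSym _ => fun=> 0%R
  | DistSym _ i d => fun a => tnth a (lshift _ i)
  end (fact_args f).

Lemma sampled_dist (r : S) (i : 'I_(ar r)) (d : num_distribution R) a
    (p : (pardim d).-tuple R) : sampled (dist_fact i a p) = tnth a i.
Proof. by rewrite /sampled /= tnth_lshift. Qed.

Lemma resample_dist (r : S) (i : 'I_(ar r)) (d : num_distribution R) y z t
    (p : (pardim d).-tuple R) :
  resample y (dist_fact i (insert_at i z t) p)
    = dist_fact i (insert_at i y t) p.
Proof.
rewrite /resample /dist_fact /=; congr (@Fact R _ xar (DistSym r i d) _).
apply: eq_from_tnth => j; rewrite tnth_mktuple.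
case: (split_ordP j) => k ->; last first.
  by rewrite !tnth_rshift -val_eqE /= gtn_eqF// ltn_addr.
rewrite !tnth_lshift (inj_eq (@lshift_inj _ _)).
case: (unliftP i k) => [l ->|->]; last by rewrite eqxx tnth_insert_at.
by rewrite !tnth_insert_at_lift eq_sym (negbTE (neq_lift _ _)).
Qed.

Lemma exists_atom_eval (nu : nat -> R) (y : R) (d : datom R nat ar) :
  atom_eval (oapp nu y) (exists_atom d) =
  dist_fact (datom_pos d)
    (insert_at (datom_pos d) y (map_tuple (term_eval nu) (datom_others d)))
    (map_tuple (term_eval nu) (datom_params d)).
Proof.
have ev (t : term R nat) :
    term_eval (oapp nu y) (term_map Some t) = term_eval nu t.
  by case: t.
rewrite /atom_eval /=.
congr (@Fact R _ xar (DistSym (datom_sym d) (datom_pos d) (datom_dist d)) _).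
apply: eq_from_tnth => j; rewrite tnth_map.
case: (split_ordP j) => k ->; last by rewrite !tnth_rshift !tnth_map ev.
rewrite !tnth_lshift; case: (unliftP (datom_pos d) k) => [l ->|->].
  by rewrite !tnth_insert_at_lift !tnth_map ev.
by rewrite !tnth_insert_at.
Qed.

End Resample.

(** * Uniqueness of samples in minimal solutions *)

Section Outcome.
Context {R : realType} {S : Type} {ar : S -> nat}.
Context {Delta : set (num_distribution R)} (G : program ar Delta).
Context (I : set (fact R ar)) (J : set (fact R (@xar R S ar))).

Lemma minimal_sub (J' : set (fact R (@xar R S ar))) :
  minimal_solution G I J -> solution G I J' -> J' `<=` J -> J `<=` J'.
Proof.
by move=> [_ minJ] solJ' J'J; apply: contrapT => nJJ'; exact: minJ solJ'.
Qed.

(** Otherwise [f] could be removed from [J]. Input facts and the conclusions of plain and projection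
    rules are base facts, hence fixed by [resample] and different from [f]; an existential head has
    the resampled fact as another witness. *)
Lemma resample_id f y :
  minimal_solution G I J -> J f -> J (resample y f) -> resample y f = f.
Proof.
move=> minJ Jf Jyf; apply: contrapT => yf_neq.
have [[symJ IJ satJ] _] := minJ.
have base_ok g : resample y g = g -> J g -> (J `\ f) g.
  by move=> yg Jg; split => // gf; apply: yf_neq; rewrite -gf.
have solJ' : solution G I (J `\ f); last first.
  by have [_ []] := minimal_sub minJ solJ' (@subDsetl _ _ _) Jf.
split.
- by move=> g [/symJ].
- by move=> _ [g Ig <-]; apply: base_ok => //; apply: IJ; exists g.
- move=> e eG nu body.
  have := satJ e eG nu (fun a ae => (body a ae).1).
  case: eG => [[rl _ <-]|[r [i [d [_ ->]]]]] /=; last exact: base_ok.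
  case: (gconcl rl) => [a|d] /=; first exact: base_ok.
  move=> [z Jz].
  have [zf|zf] := pselect (atom_eval (oapp nu z) (exists_atom d) = f);
    last first.
    by exists z.
  (* The removed fact was the witness; its resampled version is in [J], differs from it, and
     satisfies the same head. *)
  exists y.
  rewrite -zf exists_atom_eval resample_dist -exists_atom_eval in Jyf yf_neq *.
  by split.
Qed.

Lemma sample_unique (r : S) (i : 'I_(ar r)) (d : num_distribution R) y z t
    (p : (pardim d).-tuple R) :
  minimal_solution G I J ->
  J (dist_fact i (insert_at i y t) p) -> J (dist_fact i (insert_at i z t) p) ->
  y = z.
Proof.
move=> minJ Jy Jz.
have := resample_id (y := y) minJ Jz; rewrite resample_dist => /(_ Jy).
by move=> /(congr1 sampled); rewrite !sampled_dist !tnth_insert_at.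
Qed.

(** * Finite sets of values *)

Definition head_consts (h : ghead R ar) : set R :=
  match h with
  | AtomHead a => [set c | exists i, tnth (atom_args a) i = Cst c]
  | DAtomHead d => [set c | (exists i, tnth (datom_others d) i = Cst c) \/
                            (exists i, tnth (datom_params d) i = Cst c)]
  end.

Definition samples (A : set R) (h : ghead R ar) : set R :=
  match h with
  | AtomHead _ => set0
  | DAtomHead d => [set y | exists t (p : (pardim (datom_dist d)).-tuple R),
      [/\ J (dist_fact (datom_pos d) (insert_at (datom_pos d) y t) p),
          forall j, A (tnth t j) & forall j, A (tnth p j)]]
  end.

Fixpoint values (k : nat) : set R :=
  if k is k'.+1 then
    values k' `|` \bigcup_(rl in rules G) samples (values k') (gconcl rl)
  else (\bigcup_(rl in rules G) head_consts (gconcl rl)) `|`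
       (\bigcup_(f in I) range (tnth (fact_args f))).

Lemma finite_consts (T V : Type) n (t : n.-tuple (term T V)) :
  finite_set [set c | exists i, tnth t i = Cst c].
Proof.
case: n t => [|n] t; first by apply: sub_finite_set (finite_set0 _) => c [[]].
have [[c0 _]|nc] := pselect (exists c, exists i, tnth t i = Cst c); last first.
  by apply: sub_finite_set (finite_set0 _) => c tc; apply: nc; exists c.
pose F i := if tnth t i is Cst c then c else c0.
apply: sub_finite_set (finite_range_ord F) => c [i ti].
by exists i; rewrite // /F ti.
Qed.

Lemma finite_head_consts h : finite_set (head_consts h).
Proof.
case: h => [a|d] /=; first exact: finite_consts.
by rewrite finite_setU; split; exact: finite_consts.
Qed.

(** By [sample_unique] a sample is a function [F] of the other components and the parameters, which
    range over finitely many tuples. *)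
Lemma finite_samples A h :
  minimal_solution G I J -> finite_set A -> finite_set (samples A h).
Proof.
move=> minJ finA; case: h => [a|d] /=; first exact: finite_set0.
pose F (t : (ar (datom_sym d)).-1.-tuple R)
    (p : (pardim (datom_dist d)).-tuple R) :=
  xget 0%R
    [set y | J (dist_fact (datom_pos d) (insert_at (datom_pos d) y t) p)].
apply: sub_finite_set
  (finite_image2 F (finite_tuples _ finA) (finite_tuples _ finA)).
move=> y [t [p [Jy At Ap]]]; exists t => //; exists p => //.
by apply: xget_unique => // z Jz; exact: sample_unique minJ Jz Jy.
Qed.

Lemma finite_values k :
  minimal_solution G I J -> finite_set I -> finite_set (values k).
Proof.
move=> minJ finI; elim: k => [|k IHk] /=; rewrite finite_setU; split => //.
- by apply: bigcup_finite (rules_finite G) _ => rl _; exact: finite_head_consts.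
- by apply: bigcup_finite => // f _; exact: finite_range_ord.
- by apply: bigcup_finite (rules_finite G) _ => rl _; exact: finite_samples.
Qed.

Lemma sub_values m n : m <= n -> values m `<=` values n.
Proof.
move=> /subnKC <-; elim: (n - m) => [|k IHk] x; first by rewrite addn0.
by rewrite addnS => /IHk; left.
Qed.

(** * The finite subsolution *)

Definition head_xsyms (h : ghead R ar) : set (xsym R ar) :=
  match h with
  | AtomHead a => [set BaseSym (atom_sym a)]
  | DAtomHead d =>
      [set BaseSym (datom_sym d);
           DistSym (datom_sym d) (datom_pos d) (datom_dist d)]
  end.

(** The successor leaves room for samples, which lie one level above the values next to them.
    Parameters have no position in the dependency graph; they are bounded by the level of the
    sampled position. *)
Definition args_bounded (rank : position ar -> nat)
    (f : fact R (@xar R S ar)) : Prop :=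
  match fact_sym f as s return (xar s).-tuple R -> Prop with
  | BaseSym r => fun a => forall j, values (rank (Position j)).+1 (tnth a j)
  | DistSym r i d => fun a =>
      (forall j, values (rank (Position j)).+1 (tnth a (lshift _ j))) /\
      (forall j, values (rank (Position i)).+1 (tnth a (rshift _ j)))
  end (fact_args f).

(** The schemas may be infinite; restricting non-input facts to symbols arising from rule heads
    leaves finitely many symbols. *)
Definition supported (rank : position ar -> nat) : set (fact R (@xar R S ar)) :=
  [set base_fact f | f in I] `|`
  [set f | (\bigcup_(rl in rules G) head_xsyms (gconcl rl)) (fact_sym f) /\
           args_bounded rank f].

Lemma finite_supported rank N : minimal_solution G I J -> finite_set I ->
  (forall q, rank q <= N) -> finite_set (supported rank).
Proof.
move=> minJ finI rankN; rewrite finite_setU; split; first exact: finite_image.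
pose F s := [set @Fact R _ (@xar R S ar) s a | a in
  [set a | forall j, values N.+1 (tnth a j)]].
have finF : finite_set
    (\bigcup_(rl in rules G) \bigcup_(s in head_xsyms (gconcl rl)) F s).
  apply: bigcup_finite (rules_finite G) _ => rl _; apply: bigcup_finite.
    case: (gconcl rl) => [a|d] /=; first exact: finite_set1.
    by rewrite finite_setU; split; exact: finite_set1.
  by move=> s _; apply/finite_image/finite_tuples/finite_values.
have valN q : values (rank q).+1 `<=` values N.+1.
  by apply: sub_values; rewrite ltnS.
apply: sub_finite_set finF => -[s args] [/= [rl rlG sh] bnd].
exists rl => //; exists s => //; exists args => //=.
case: s args bnd {sh} => [r|r i d] args; rewrite /args_bounded /=.
  by move=> bnd j; apply: valN; exact: bnd.
move=> [bnd1 bnd2] j.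
by case: (split_ordP j) => k ->; apply: valN; [exact: bnd1|exact: bnd2].
Qed.

Lemma head_xsyms_idb rl r :
  rules G rl -> head_xsyms (gconcl rl) (BaseSym r) -> idb G r.
Proof.
move=> /rules_wf[_ + _ _].
by case: (gconcl rl) => [a|d] /= iG; [move=> [->]|move=> [[->]|]].
Qed.

(** An input fact contributes only values of level 0. Any other supported fact over a base symbol
    has the symbol of a rule head, so its positions belong to [idb G] and can be sources of
    edges. *)
Lemma body_value rank rl (nu : nat -> R) x : rules G rl -> gbody_vars rl x ->
  (forall a, List.In a (ebody (xrule rl)) -> supported rank (atom_eval nu a)) ->
  values 0 (nu x) \/ exists q, [/\ idb G (pos_sym q), body_occurs x rl q &
                                  values (rank q).+1 (nu x)].
Proof.
move=> rlG [a ab [i ai]] body.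
have {body} := body (base_atom a) (List.in_map _ _ _ ab).
case=> [[f If fa]|[[rl' rl'G sym] bnd]].
  left; right; exists f => //.
  have : range (tnth (fact_args (atom_eval nu (base_atom a)))) (nu x).
    by exists i; rewrite // tnth_map ai.
  by rewrite -fa.
right; exists (Position i); split; first exact: head_xsyms_idb rl'G sym.
  by exists a => //; exists i.
by have := bnd i; rewrite tnth_map ai.
Qed.

(** [J] provides each conclusion or witness, so only the bounds need checking: normal edges carry
    them to the head, special edges put everything exported to a Delta-atom below the level of its
    sample, and projections keep positions. *)
Lemma supported_solution rank : solution G I J ->
  (forall q q', edge G Normal q q' -> rank q <= rank q') ->
  (forall q q', edge G Special q q' -> rank q < rank q') ->
  solution G I (J `&` supported rank).
Proof.
move=> [symJ IJ satJ] rankN rankS; split.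
- by move=> f [/symJ].
- by move=> f If; split; [exact: IJ|left].
move=> e eG nu body; have := satJ e eG nu (fun a ae => (body a ae).1).
have {body} := fun a ae => (body a ae).2.
case: eG => [[rl rlG <-]|[r [i [d [[rl rlG [p [t rlE]]] ->]]]]].
  move=> /(body_value rlG) bodyv.
  have [_ _ _ hb] := rules_wf rlG.
  have normal x q' : head_occurs x (gconcl rl) q' ->
      ghead_vars (gconcl rl) x -> values (rank q').+1 (nu x).
    move=> xq' /hb/bodyv[|[q [iq xq]]]; first exact: sub_values.
    apply: sub_values; rewrite ltnS; apply: rankN; split => //.
    by exists rl => //; exists x.
  (* The strict increase of the rank absorbs the successor in the bound at the source. *)
  have special d x : gconcl rl = DAtomHead d -> datom_vars d x ->
      values (rank (Position (datom_pos d))) (nu x).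
    move=> rd dx; have /hb/bodyv : ghead_vars (gconcl rl) x by rewrite rd.
    case=> [|[q [iq xq]]]; first exact: sub_values.
    apply: sub_values; apply: rankS; split => //; exists rl => //.
    by exists x => //; exists d.
  have consts k c : head_consts (gconcl rl) c -> values k c.
    by move=> hc; apply: (@sub_values 0) => //; left; exists rl.
  rewrite /=; case rlE : (gconcl rl) => [a|d] /=.
    move=> Ja; split => //; right; split.
      by exists rl => //; rewrite rlE.
    move=> j; rewrite tnth_map; case aj : (tnth (atom_args a) j) => [x|c] /=.
      by apply: normal; rewrite rlE; exists j.
    by apply: (consts _.+1); rewrite rlE; exists j.
  move=> [y Jy]; exists y; split => //; right; split.
    by exists rl => //; rewrite rlE; right.
  have others j : values (rank (Position (datom_pos d)))
      (tnth (map_tuple (term_eval nu) (datom_others d)) j).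
    rewrite tnth_map; case aj : (tnth (datom_others d) j) => [x|c] /=.
      by apply: special rlE _; left; exists j.
    by apply: consts; rewrite rlE; left; exists j.
  have params j : values (rank (Position (datom_pos d)))
      (tnth (map_tuple (term_eval nu) (datom_params d)) j).
    rewrite tnth_map; case aj : (tnth (datom_params d) j) => [x|c] /=.
      by apply: special rlE _; right; exists j.
    by apply: consts; rewrite rlE; right; exists j.
  rewrite exists_atom_eval in Jy *; split=> j /=; last first.
    by rewrite tnth_rshift; left.
  rewrite tnth_lshift; case: (unliftP (datom_pos d) j) => [k ->|->].
    rewrite tnth_insert_at_lift tnth_map.
    case aj : (tnth (datom_others d) k) => [x|c] /=.
      by apply: normal; rewrite rlE; [exists k|left; exists k].
    by apply: (consts _.+1); rewrite rlE; left; exists k.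
  (* The witness occurs in [J] next to values of level [rank (Position (datom_pos d))], so it is one
     of the samples added at the next level. *)
  rewrite tnth_insert_at; right; exists rl => //; rewrite rlE /=.
  by do 2 eexists; split; [exact: Jy|exact: others|exact: params].
move=> body /= Jf; split => //; right; split.
  by exists rl => //; rewrite rlE; left.
have := body _ (List.in_eq _ _).
(* The premise of a projection rule is distributional, hence not an input fact; its bounds on the
   first components are those required of the conclusion. *)
case=> [[f _ /(congr1 (@fact_sym _ _ _))]//|[_ [bnd _]]].
by move=> j; have := bnd j; rewrite /= !tnth_map !tnth_ord_tuple.
Qed.

End Outcome.

Theorem theorem3p6 (R : realType) (S : Type) (ar : S -> nat)
    (Delta : set (num_distribution R)) (Delta_finite : finite_set Delta)
    (G : program ar Delta) (G_weakly_acyclic : weakly_acyclic G)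
    (I : set (fact R ar)) (I_input : input_instance G I) :
  possible_outcomes G I = fin_possible_outcomes G I.
Proof.
apply/seteqP; split=> [J Jout|J []//]; split => //.
have [minJ _] := Jout; have [solJ _] := minJ.
have [rank [N [rank_le rankN rankS]]] := exists_rank G_weakly_acyclic.
have solJ' := supported_solution solJ rankN rankS.
apply: sub_finite_set (finite_supported minJ I_input.1 rank_le).
by move=> f /(minimal_sub minJ solJ' (@subIsetl _ _ _))[].
Qed.
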